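(* Let $n\ge 2$ and $m\ge 1$ be integers, $p\in[1,n)$, $Q\in\mathcal{K}_o^{1,m}$, and let $K\subset M_{n,1}(\mathbb{R})=\mathbb{R}^n$ be compact. Then: i) (Upper semi-continuity) For each $\varepsilon>0$ there is an open set $O$ (with $K\subset O$) such that for every compact set $F$ with $K\subset F\subset O$ one has $C_{p,Q}(F)\le C_{p,Q}(K)+\varepsilon$. ii) (Continuity from above) If $\{K_j\}_{j\in\mathbb{N}}$ is a sequence of compact subsets of $\mathbb{R}^n$ such that $K_{j+1}\subset K_j$ for all $j\in\mathbb{N}$, then $$\lim_{j\to\infty}C_{p,Q}(K_j)=C_{p,Q}\Big(\bigcap_{j=1}^\infty K_j\Big).$$
   Context: $M_{n,m}(\mathbb{R})$ is the space of real $n\times m$ matrices with inner product $\mathrm{tr}(x^{\mathrm T}y)$ and the induced norm; $S^{nm-1}$ is its unit sphere and $du$ the spherical (Hausdorff) measure on it. $M_{n,1}(\mathbb{R})$ and $M_{1,m}(\mathbb{R})$ are identified with $\mathbb{R}^n$ and $\mathbb{R}^m$. $\mathcal{K}_o^{1,m}$ is the set of compact convex sets with nonempty interior in $M_{1,m}(\mathbb{R})$ containing the origin $o$. The support function is $h_Q(x)=\max\{x\cdot y:y\in Q\}$. For a smooth compactly supported $f:\mathbb{R}^n\to\mathbb{R}$ (i.e. $f\in C_c^\infty$) and $u\in S^{nm-1}$, put $\nabla_u f(x)=(\nabla f(x))^{\mathrm T}u\in M_{1,m}(\mathbb{R})$ (matrix product) and $\|h_Q(\nabla_u f)\|_p=\big(\int_{\mathbb{R}^n}h_Q(\nabla_u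 f(x))^p\,dx\big)^{1/p}$. For compact $K\subset\mathbb{R}^n$, the $m$th order $p$-affine capacity is $$C_{p,Q}(K)=\inf\Big\{\Big(\int_{S^{nm-1}}\|h_Q(\nabla_u f)\|_p^{-nm}\,du\Big)^{-\frac{p}{nm}}: f\in C_c^\infty,\ f\ge 1\text{ on }K\Big\},$$ with the conventions $0^{-a}=\infty$, $\infty^{-a}=0$ for $a>0$. *)

(* Defs.v *)
From HB Require Import structures.
From mathcomp Require Import all_boot all_order all_algebra.
From mathcomp Require Import all_classical all_reals all_analysis.
Set Implicit Arguments.
Unset Strict Implicit.
Unset Printing Implicit Defensive.
Import Order.TTheory GRing.Theory Num.Theory.
Import numFieldNormedType.Exports.
Local Open Scope classical_set_scope.
Local Open Scope ring_scope.

(* The outer measure generated by a gauge [g] on arbitrary subsets of [T];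
   [g B = +oo] excludes [B] from the coverings. *)
Section CoverExt.
Local Open Scope ereal_scope.
Context {R : realType} {T : pointedType}.

Definition cover_ext (g : set T -> \bar R) (A : set T) : \bar R :=
  ereal_inf [set \sum_(k <oo) g (B k) |
    B in [set B : (set T)^nat | A `<=` \bigcup_k B k]].

Let D := g_sigma_algebraType [set: set T].

Lemma cover_extE g : cover_ext g = @mu_ext _ D R g.
Proof.
apply/funext => A; rewrite /cover_ext /mu_ext; congr (ereal_inf (image _ _)).
apply/seteqP; split => B; last by case.
by move=> AB; split => // i; apply: sub_sigma_algebra.
Qed.

Variables (g : set T -> \bar R) (g0 : g set0 = 0) (g_ge0 : forall X, 0 <= g X).

Lemma cover_ext0 : cover_ext g set0 = 0.
Proof. by rewrite cover_extE; exact: mu_ext0. Qed.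

Lemma cover_ext_ge0 A : 0 <= cover_ext g A.
Proof. by rewrite cover_extE; exact: mu_ext_ge0. Qed.

Lemma le_cover_ext : {homo cover_ext g : A B / A `<=` B >-> A <= B}.
Proof. by move=> A B AB; rewrite cover_extE; apply: (@le_mu_ext _ D). Qed.

Lemma cover_ext_sigma_subadditive : sigma_subadditive (cover_ext g).
Proof. by rewrite cover_extE => F; apply: (@mu_ext_sigma_subadditive _ D). Qed.

End CoverExt.

Section Euclidean.
Context {R : realType} {n m : nat}.

Definition mxdot (x y : 'M[R]_(n, m)) : R := \tr (x^T *m y).

(* The norm [`|x|] of the library on matrices is the maximum norm. *)
Definition mxnorm2 (x : 'M[R]_(n, m)) : R := Num.sqrt (mxdot x x).

Definition mxsphere : set 'M[R]_(n, m) := [set x | mxnorm2 x = 1].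

Definition mxbox (a b : 'M[R]_(n, m)) : set 'M[R]_(n, m) :=
  [set x | forall i j, a i j <= x i j <= b i j].

Local Open Scope ereal_scope.

(* The volume of a nonempty compact box, [+oo] on every other nonempty set. *)
Definition box_gauge (B : set 'M[R]_(n, m)) : \bar R :=
  if B == set0 then 0 else
  ereal_inf [set (\prod_(i < n) \prod_(j < m) (ab.2 i j - ab.1 i j))%R%:E |
    ab in [set ab : 'M[R]_(n, m) * 'M[R]_(n, m) |
      (forall i j, (ab.1 i j <= ab.2 i j)%R) /\ B = mxbox ab.1 ab.2]].

Lemma box_gauge0 : box_gauge set0 = 0.
Proof. by rewrite /box_gauge eqxx. Qed.

Lemma box_gauge_ge0 B : 0 <= box_gauge B.
Proof.
rewrite /box_gauge; case: ifPn => // _.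
apply: le_ereal_inf_tmp => _ [ab [abP _] <-]; rewrite lee_fin.
by do 2!(apply: prodr_ge0 => ? _); rewrite subr_ge0.
Qed.

Definition lebesgue_outer : set 'M[R]_(n, m) -> \bar R := cover_ext box_gauge.

HB.instance Definition _ := isOuterMeasure.Build R 'M[R]_(n, m) lebesgue_outer
  (cover_ext0 box_gauge0 box_gauge_ge0) (cover_ext_ge0 box_gauge_ge0)
  (@le_cover_ext _ _ box_gauge)
  (cover_ext_sigma_subadditive box_gauge_ge0).

Definition mxlebesgue : set (caratheodory_type lebesgue_outer) -> \bar R :=
  lebesgue_outer.

HB.instance Definition _ := isMeasure.Build _ _ _ mxlebesgue
  (@caratheodory_measure0 _ _ lebesgue_outer)
  (@caratheodory_measure_ge0 _ _ lebesgue_outer)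
  (@caratheodory_measure_sigma_additive _ _ lebesgue_outer).

End Euclidean.

Section Hausdorff.
Local Open Scope ereal_scope.
Context {R : realType} {n m : nat}.

Definition unit_ball_volume (d : nat) : \bar R :=
  lebesgue_outer [set x : 'cV[R]_d | (mxnorm2 x <= 1)%R].

Definition mxdiam (B : set 'M[R]_(n, m)) : \bar R :=
  ereal_sup [set (mxnorm2 (x - y))%:E | x in B & y in B].

Definition hausdorff_gauge (d : nat) (delta : R) (B : set 'M[R]_(n, m)) :
    \bar R :=
  if B == set0 then 0 else
  if mxdiam B <= delta%:E then
    unit_ball_volume d * ((fine (mxdiam B) / 2) ^+ d)%R%:E
  else +oo.

Lemma hausdorff_gauge0 d delta : hausdorff_gauge d delta set0 = 0.
Proof. by rewrite /hausdorff_gauge eqxx. Qed.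

Lemma hausdorff_gauge_ge0 d delta B : 0 <= hausdorff_gauge d delta B.
Proof.
rewrite /hausdorff_gauge; case: ifPn => // /set0P[x Bx]; case: ifPn => // _.
rewrite mule_ge0 ?outer_measure_ge0 // lee_fin exprn_ge0 // divr_ge0 //.
apply: fine_ge0; apply: ereal_sup_ge.
exists (mxnorm2 (x - x))%:E; last by rewrite lee_fin sqrtr_ge0.
by exists x => //; exists x.
Qed.

(* The [d]-dimensional Hausdorff measure of the Euclidean distance, normalized
   so that it is the Lebesgue measure in dimension [d]. *)
Definition hausdorff_outer (d : nat) (A : set 'M[R]_(n, m)) : \bar R :=
  ereal_sup [set cover_ext (hausdorff_gauge d delta) A |
    delta in [set delta : R | (0 < delta)%R]].

Section Props.
Variable d : nat.

Lemma hausdorff_outer_ub delta A : (0 < delta)%R ->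
  cover_ext (hausdorff_gauge d delta) A <= hausdorff_outer d A.
Proof. by move=> delta0; apply: ereal_sup_ubound; exists delta. Qed.

Lemma hausdorff_outer_ge0 A : 0 <= hausdorff_outer d A.
Proof.
apply: le_trans (hausdorff_outer_ub A (@ltr01 R)).
exact/cover_ext_ge0/hausdorff_gauge_ge0.
Qed.

Lemma hausdorff_outer0 : hausdorff_outer d set0 = 0.
Proof.
apply/eqP; rewrite eq_le hausdorff_outer_ge0 andbT.
apply: ge_ereal_sup => _ [delta _ <-].
by rewrite (cover_ext0 (hausdorff_gauge0 _ _) (hausdorff_gauge_ge0 _ _)).
Qed.

Lemma le_hausdorff_outer :
  {homo hausdorff_outer d : A B / A `<=` B >-> A <= B}.
Proof.
move=> A B AB; apply: ge_ereal_sup => _ [delta delta0 <-].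
exact: le_trans (le_cover_ext _ AB) (hausdorff_outer_ub B delta0).
Qed.

Lemma hausdorff_outer_sigma_subadditive :
  sigma_subadditive (hausdorff_outer d).
Proof.
move=> F; apply: ge_ereal_sup => _ [delta delta0 <-].
apply: le_trans (cover_ext_sigma_subadditive
  (hausdorff_gauge_ge0 _ _) F) _.
apply: lee_nneseries => k _ *; last exact: hausdorff_outer_ub.
exact/cover_ext_ge0/hausdorff_gauge_ge0.
Qed.

HB.instance Definition _ := isOuterMeasure.Build R 'M[R]_(n, m)
  (hausdorff_outer d) hausdorff_outer0 hausdorff_outer_ge0 le_hausdorff_outer
  hausdorff_outer_sigma_subadditive.

Definition mxhausdorff : set (caratheodory_type (hausdorff_outer d)) -> \bar R :=
  hausdorff_outer d.

HB.instance Definition _ := isMeasure.Build _ _ _ mxhausdorff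
  (@caratheodory_measure0 _ _ (hausdorff_outer d))
  (@caratheodory_measure_ge0 _ _ (hausdorff_outer d))
  (@caratheodory_measure_sigma_additive _ _ (hausdorff_outer d)).

End Props.
End Hausdorff.
Arguments mxhausdorff {R n m} d _.

Section Smooth.
Context {R : realType} {n : nat}.
Implicit Types f : 'cV[R]_n -> R.

Definition partial (i : 'I_n) f (x : 'cV[R]_n) : R := 'D_(delta_mx i 0) f x.

Fixpoint Ck (k : nat) f : Prop :=
  continuous f /\
  if k is k'.+1 then
    forall i : 'I_n,
      (forall x, derivable f x (delta_mx i 0)) /\ Ck k' (partial i f)
  else True.

Definition Ccinfty f : Prop :=
  (forall k, Ck k f) /\ compact (closure [set x | f x != 0]).

Definition gradient f (x : 'cV[R]_n) : 'cV[R]_n := \col_i partial i f x.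

Definition nabla m (u : 'M[R]_(n, m)) f (x : 'cV[R]_n) : 'rV[R]_m :=
  (gradient f x)^T *m u.

End Smooth.

Definition convex_body_o (R : realType) (m : nat) (Q : set 'rV[R]_m) : Prop :=
  [/\ compact Q, convex_set Q, interior Q !=set0 & Q 0].

(* For a nonempty compact [Q] the supremum is a maximum. *)
Definition support_fun (R : realType) (m : nat) (Q : set 'rV[R]_m)
    (x : 'rV[R]_m) : R :=
  sup [set mxdot x y | y in Q].

Section Capacity.
Local Open Scope ereal_scope.
Context {R : realType} {n m : nat}.

(* [x^{-a}] for [x >= 0] and [a > 0], with [0^{-a} = +oo] and [+oo^{-a} = 0];
   [poweR] itself has [0 `^ (- a) = 0] and [+oo `^ (- a) = +oo]. *)
Definition negpow (x : \bar R) (a : R) : \bar R := (x `^ a)^-1.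

Definition nabla_norm (p : R) (Q : set 'rV[R]_m) (f : 'cV[R]_n -> R)
    (u : 'M[R]_(n, m)) : \bar R :=
  (\int[mxlebesgue]_x (support_fun Q (nabla u f (x : 'cV[R]_n)) `^ p)%R%:E)
    `^ p^-1.

Definition capacity_energy (p : R) (Q : set 'rV[R]_m) (f : 'cV[R]_n -> R) :
    \bar R :=
  negpow (\int[mxhausdorff (n * m).-1]_(u in mxsphere)
            negpow (nabla_norm p Q f (u : 'M[R]_(n, m))) (n * m)%:R)
         (p / (n * m)%:R).

Definition capacity (p : R) (Q : set 'rV[R]_m) (K : set 'cV[R]_n) : \bar R :=
  ereal_inf [set capacity_energy p Q f |
    f in [set f | Ccinfty f /\ forall x, K x -> (1 <= f x)%R]].

End Capacity.

(* Main.v *)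
Require Import Defs.
From mathcomp Require Import all_boot all_order all_algebra.
From mathcomp Require Import all_classical all_reals all_analysis.
Import Order.TTheory GRing.Theory Num.Theory.
Import numFieldNormedType.Exports.
Local Open Scope classical_set_scope.
Local Open Scope ring_scope.

(** The energy is positively homogeneous: replacing [f] by [t f] with [t > 0] multiplies it by [t^p]
    ([capacity_energyZ]), because support function, gradient and integral all scale. For (i), take
    [f] almost optimal for [K] and [t > 1] close to 1. Then [t f] is admissible for every subset of
    the open set [f > 1 / t], which contains [K], and its energy is still below the capacity of [K]
    plus epsilon ([capacity_upper_semicontinuous]). For (ii), monotonicity makes the capacities of
    the [K_ j] nonincreasing, with the capacity of the intersection as a lower bound. By compactness
    some [K_ j] lies in the open set that (i) gives for the intersection
    ([nested_compact_sub_open]), so their infimum is no larger. *)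

Lemma gt0_supZ (R : realType) (t : R) (A : set R) : 0 < t ->
  sup [set t * x | x in A] = t * sup A.
Proof.
have le_sup (s : R) (B : set R) : 0 < s -> has_sup B ->
    has_sup [set s * x | x in B] /\ sup [set s * x | x in B] <= s * sup B.
  move=> s0 [[x Bx] ubB].
  have ubsB : ubound [set s * x | x in B] (s * sup B).
    by move=> _ [y By <-]; rewrite ler_pM2l//; exact: ub_le_sup.
  have nesB : [set s * x | x in B] !=set0 by exists (s * x); exists x.
  by split; [split=> //; exists (s * sup B)|exact: ge_sup].
have imK (s : R) (B : set R) : 0 < s ->
    [set s^-1 * x | x in [set s * x | x in B]] = B.
  move=> s0; rewrite image_comp -[RHS]image_id; apply: eq_imagel => x _ /=.
  by rewrite mulKf// gt_eqF.
(* Without a supremum both sides are the default value 0: a supremum of the scaled set would give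
   one of [A] after scaling back by [t^-1]. *)
move=> t0; have [supA|nsupA] := pselect (has_sup A); last first.
  rewrite !sup_out ?mulr0// => suptA; apply: nsupA.
  by rewrite -(imK t A)//; apply: (le_sup _ _ _ _).1; rewrite ?invr_gt0.
have [suptA le_tA] := le_sup t A t0 supA.
apply/eqP; rewrite eq_le le_tA/= -ler_pdivlMl//.
have t'0 : 0 < t^-1 by rewrite invr_gt0.
by have [_] := le_sup t^-1 _ t'0 suptA; rewrite imK.
Qed.

Section IntegralScaling.
Local Open Scope ereal_scope.
Import HBNNSimple.

(* The library defines the integral of any nonnegative function, measurable or
   not, as a supremum over the simple functions below it, which scales. *)
Lemma gt0_integralZl d (T : measurableType d) (R : realType)
    (mu : {measure set T -> \bar R}) (D : set T) (f : T -> \bar R) (t : R) :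
  (0 < t)%R -> (forall x, D x -> 0 <= f x) ->
  \int[mu]_(x in D) (t%:E * f x) = t%:E * \int[mu]_(x in D) f x.
Proof.
have le_integralZ (s : R) (g : T -> \bar R) : (0 < s)%R ->
    (forall x, D x -> 0 <= g x) ->
    s%:E * \int[mu]_(x in D) g x <= \int[mu]_(x in D) (s%:E * g x).
  move=> s0 g0; rewrite !ge0_integralE//; last first.
    by move=> x Dx; rewrite mule_ge0 ?lee_fin ?(ltW s0) ?g0.
  rewrite -ereal_sup_pZl//; apply: ge_ereal_sup => _ [_ [h hg <-] <-].
  apply: ereal_sup_ubound; exists (scale_nnsfun h (ltW s0)).
    move=> x /=; rewrite patchE; case: ifPn => xD.
      (* Off [D] the integrand is extended by 0, so [h x <= 0] there, and scaling preserves this. *)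
      by rewrite EFinM lee_pmul2l//; move: (hg x); rewrite patchE xD.
    have := hg x; rewrite patchE (negbTE xD) !lee_fin => hx0.
    by rewrite /= pmulr_rle0.
  exact: sintegralrM.
(* The converse is the same inequality for the scale [t^-1] and the integrand [t f]. *)
move=> t0 f0; apply/eqP; rewrite eq_le le_integralZ// andbT.
have t'0 : (0 < t^-1)%R by rewrite invr_gt0.
rewrite -lee_pdivrMl// (le_trans (le_integralZ _ _ t'0 _))//.
  by move=> x Dx; rewrite mule_ge0 ?lee_fin ?(ltW t0) ?f0.
rewrite le_eqVlt; apply/orP; left; apply/eqP/eq_integral => x _.
by rewrite muleA -EFinM mulVf ?mul1e// gt_eqF.
Qed.

End IntegralScaling.

(** * Homogeneity of the energy *)

Section Scaling.
Context {R : realType} {n : nat}.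
Implicit Types (f : 'cV[R]_n -> R) (t : R).

Lemma partialZ t (i : 'I_n) f : (forall x, derivable f x (delta_mx i 0)) ->
  partial i (t \*: f) = t \*: partial i f.
Proof. by move=> df; apply/funext => x; rewrite /partial deriveZ. Qed.

Lemma CkZ k t f : Ck k f -> Ck k (t \*: f).
Proof.
elim: k f => [|k IHk] f /= [cf Df].
  by split=> // x; exact/continuousZr/cf.
split=> [x|i]; first exact/continuousZr/cf.
have [df Ckf] := Df i; split=> [x|]; first exact: derivableZ.
by rewrite partialZ//; exact: IHk.
Qed.

Lemma CcinftyZ t f : t != 0 -> Ccinfty f -> Ccinfty (t \*: f).
Proof.
move=> t0 [Ckf cf]; split=> [k|]; first exact: CkZ.
suff -> : [set x | (t \*: f) x != 0] = [set x | f x != 0] by [].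
by apply/funext => x /=; rewrite /= scaler_eq0 (negbTE t0).
Qed.

Lemma Ccinfty_derivable f x i : Ccinfty f -> derivable f x (delta_mx i 0).
Proof. by move=> [/(_ 1)[_ /(_ i)[]]]. Qed.

Lemma Ccinfty_continuous f : Ccinfty f -> continuous f.
Proof. by move=> [/(_ 0)[]]. Qed.

Context {m : nat}.
Implicit Types (Q : set 'rV[R]_m) (u : 'M[R]_(n, m)).

Lemma nablaZ t f u x : Ccinfty f -> nabla u (t \*: f) x = t *: nabla u f x.
Proof.
move=> Cf; rewrite /nabla scalemxAl; congr (_ *m _).
apply/matrixP => i j; rewrite !mxE partialZ// => y.
exact: Ccinfty_derivable.
Qed.

Lemma support_funZ t Q (x : 'rV[R]_m) : 0 < t ->
  support_fun Q (t *: x) = t * support_fun Q x.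
Proof.
move=> t0; rewrite /support_fun -gt0_supZ// image_comp.
congr (sup (image _ _)); apply/funext => y /=.
by rewrite /mxdot linearZ/= -scalemxAl mxtraceZ.
Qed.

Lemma support_fun_ge0 Q (x : 'rV[R]_m) : Q 0 -> 0 <= support_fun Q x.
Proof.
move=> Q0; rewrite /support_fun.
have [[_ ubA]|/sup_out ->//] := pselect (has_sup [set mxdot x y | y in Q]).
by apply: ub_le_sup => //; exists 0; rewrite // /mxdot mulmx0 mxtrace0.
Qed.

Local Open Scope ereal_scope.

(** As [t^a] is positive and finite, inversion distributes over the product even when [x^a] is 0 or
    infinite. *)
Lemma negpowZ (t a : R) (x : \bar R) : (0 < t)%R -> 0 <= x ->
  negpow (t%:E * x) a = (t `^ (- a))%R%:E * negpow x a.
Proof.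
move=> t0 x0; have ta0 : (0 < t `^ a)%R by rewrite powR_gt0.
have ta_neq0 : (t `^ a)%R != 0%R by rewrite gt_eqF.
rewrite /negpow poweRM ?lee_fin ?(ltW t0)// poweR_EFin powRN.
rewrite inveM ?inver ?(negbTE ta_neq0)//.
have := poweR_ge0 x a; case: (x `^ a) => [r||]//= r0.
by rewrite /inveM_def (negbTE ta_neq0)/= (ltW ta0) implybT.
Qed.

Lemma nabla_norm_ge0 p Q f u : 0 <= nabla_norm p Q f u.
Proof. exact: poweR_ge0. Qed.

Lemma negpow_ge0 (x : \bar R) a : 0 <= negpow x a.
Proof. by rewrite /negpow inve_ge0 poweR_ge0. Qed.

Lemma nabla_normZ (p t : R) Q f u : (p != 0)%R -> (0 < t)%R -> Q 0%R ->
  Ccinfty f -> nabla_norm p Q (t \*: f)%R u = t%:E * nabla_norm p Q f u.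
Proof.
move=> p0 t0 Q0 Cf; rewrite /nabla_norm.
have hZ x : (support_fun Q (nabla u (t \*: f)%R x) `^ p)%R%:E =
    (t `^ p)%R%:E * (support_fun Q (nabla u f x) `^ p)%R%:E.
  by rewrite nablaZ// support_funZ// powRM ?(ltW t0) ?support_fun_ge0// EFinM.
transitivity (((t `^ p)%R%:E * \int[mxlebesgue]_x
    (support_fun Q (nabla u f (x : 'cV[R]_n)) `^ p)%R%:E) `^ p^-1).
  congr (_ `^ _); rewrite -gt0_integralZl ?powR_gt0//.
    by apply: eq_integral => x _; exact: hZ.
  by move=> x _; rewrite lee_fin powR_ge0.
rewrite poweRM ?lee_fin ?powR_ge0//; last first.
  by apply: integral_ge0 => x _; rewrite lee_fin powR_ge0.
by rewrite poweR_EFin -powRrM mulfV// powRr1// ltW.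
Qed.

(** The norm has degree 1 in [f], and the two exponents [- nm] and [- p / (nm)] multiply to [p]. *)
Lemma capacity_energyZ (p t : R) Q f : (0 < n * m)%N -> (p != 0)%R ->
  (0 < t)%R -> Q 0%R -> Ccinfty f ->
  capacity_energy p Q (t \*: f)%R = (t `^ p)%R%:E * capacity_energy p Q f.
Proof.
move=> nm0 p0 t0 Q0 Cf; rewrite /capacity_energy.
have hZ (u : 'M[R]_(n, m)) :
    negpow (nabla_norm p Q (t \*: f)%R u) (n * m)%:R =
    (t `^ (- (n * m)%:R))%R%:E * negpow (nabla_norm p Q f u) (n * m)%:R.
  by rewrite nabla_normZ// negpowZ ?nabla_norm_ge0.
transitivity (negpow ((t `^ (- (n * m)%:R))%R%:E *
    \int[mxhausdorff (n * m).-1]_(u in mxsphere)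
      negpow (nabla_norm p Q f (u : 'M[R]_(n, m))) (n * m)%:R)
    (p / (n * m)%:R)).
  congr (negpow _ _); rewrite -gt0_integralZl ?powR_gt0//.
    by apply: eq_integral => u _; exact: hZ.
  by move=> u _; exact: negpow_ge0.
rewrite negpowZ ?powR_gt0//; last first.
  by apply: integral_ge0 => u _; exact: negpow_ge0.
rewrite -powRrM mulrNN mulrCA mulfV ?mulr1//.
by rewrite pnatr_eq0 -lt0n.
Qed.

(** * Order and continuity properties of the capacity *)

Lemma capacity_ge0 p Q K : 0 <= capacity (R:=R) (n:=n) p Q K.
Proof. by apply: le_ereal_inf_tmp => _ [f _ <-]; exact: negpow_ge0. Qed.

Lemma le_capacity p Q : {homo @capacity R n m p Q : A B / A `<=` B >-> A <= B}.
Proof.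
move=> A B AB; apply: le_ereal_inf => _ [f [Cf f1] <-].
by exists f => //; split=> // x /AB/f1.
Qed.

(* Scaling an almost optimal [f] by [t > 1] makes it admissible for every
   subset of the open set [f > 1 / t]. *)
Lemma capacity_upper_semicontinuous (p : R) Q K (eps : R) :
  (0 < n * m)%N -> (0 < p)%R -> Q 0%R -> (0 < eps)%R ->
  exists O : set 'cV[R]_n, [/\ open O, K `<=` O &
    forall F, F `<=` O -> capacity p Q F <= capacity p Q K + eps%:E].
Proof.
move=> nm0 p0 Q0 eps0.
have [->|Kfin] := eqVneq (capacity p Q K) +oo.
  exists setT; split=> //; first exact: openT.
  by move=> F _; rewrite addye// leey.
have {}Kfin : capacity p Q K \is a fin_num.
  by rewrite ge0_fin_numE ?capacity_ge0// lt_neqAle Kfin leey.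
have [_ [f [Cf f1] <-] ltE] := lb_ereal_inf_adherent eps0 Kfin.
have [t t1 leE] : exists2 t : R, (1 < t)%R &
    (t `^ p)%R%:E * capacity_energy p Q f <= capacity p Q K + eps%:E.
  move: ltE; rewrite -/(capacity p Q K) -(fineK Kfin) -EFinD.
  set c := (fine _ + _)%R.
  case E: (capacity_energy p Q f) => [e||]//; last first.
    by have := negpow_ge0 _ _ : 0 <= capacity_energy p Q f; rewrite E.
  rewrite lte_fin => ec.
  have e0 : (0 <= e)%R by rewrite -lee_fin -E negpow_ge0.
  have e1 : (0 < e + 1)%R by rewrite ltr_wpDl.
  (* This [s > 1] satisfies [s e <= c], since [e / (e + 1) <= 1]; dividing by [e + 1] covers the
     case [e = 0]. The scale [t] is its [p]-th root. *)
  pose s := (1 + (c - e) / (e + 1))%R.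
  have s1 : (1 < s)%R by rewrite ltrDl divr_gt0// subr_gt0.
  exists (s `^ p^-1)%R.
    have <- : (1 `^ p^-1)%R = 1%R :> R by rewrite powR1.
    rewrite gt0_ltr_powR ?invr_gt0 ?nnegrE//.
    by rewrite ltW// (lt_trans _ s1).
  rewrite -powRrM mulVf ?gt_eqF// powRr1 ?(ltW (lt_trans _ s1))// lee_fin.
  rewrite mulrDl mul1r -lerBrDl -mulrA ler_piMr ?subr_ge0 ?(ltW ec)//.
  by rewrite ler_pdivrMl// mulr1 lerDl.
have t0 : (0 < t)%R by rewrite (lt_trans _ t1).
exists [set x | (t^-1 < f x)%R]; split.
- apply: (@open_comp _ _ f [set y | (t^-1 < y)%R]); last exact: open_gt.
  by move=> x _; exact: (Ccinfty_continuous f Cf).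
- by move=> x /f1; apply: lt_le_trans; rewrite invf_lt1.
- move=> F FO; rewrite -capacity_energyZ ?gt_eqF// in leE.
  apply: le_trans leE; apply: ereal_inf_lbound; exists (t \*: f)%R => //.
  split; first by apply: CcinftyZ => //; rewrite gt_eqF.
  by move=> x /FO /= /ltW; rewrite -ler_pdivrMl// mulr1.
Qed.

End Scaling.

(** Otherwise the sets [K_ j] minus [O], closed in the compact [K_ 0], have the finite intersection
    property; a common point would lie in every [K_ j] but outside [O]. *)
Lemma nested_compact_sub_open (T : ptopologicalType) (K_ : nat -> set T) O :
  hausdorff_space T -> (forall j, compact (K_ j)) ->
  (forall j, K_ j.+1 `<=` K_ j) -> open O -> \bigcap_j K_ j `<=` O ->
  exists j, K_ j `<=` O.
Proof.
move=> hT cK dK oO KO; apply: contrapT => /forallNP nKO.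
have dK' i j : (i <= j)%N -> K_ j `<=` K_ i.
  move=> /subnK <-; elim: (j - i)%N => [//|k IHk].
  exact: subset_trans (dK _) IHk.
have := cK 0; rewrite compact_In0.
move=> /(_ _ setT (fun j => K_ j `&` ~` O)) [].
- exists (fun j => K_ j `&` ~` O) => j _.
    by apply: closedI; [exact: compact_closed|exact: open_closedC].
  by rewrite setIA [X in _ = X `&` _](setIidr (dK' _ _ (leq0n j))).
(* By nestedness, a point of [K_ j] outside [O] for the largest index [j] in [D] serves for all
   indices in [D]. *)
- move=> D _.
  have /nonsubset[x [Kx nOx]] := nKO (\max_(j <- finmap.enum_fset D) j)%N.
  by exists x => j jD; split=> //; apply: dK' Kx; exact: leq_bigmax_seq.
- move=> x xK; have [_] := xK 0 I; apply.
  by apply: KO => j jI; exact: (xK j jI).1.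
Qed.

Theorem proposition3p6 (R : realType) (n m : nat) (p : R)
    (Q : set 'rV[R]_m) (K : set 'cV[R]_n) :
  (2 <= n)%N -> (1 <= m)%N -> 1 <= p -> p < n%:R ->
  convex_body_o Q -> compact K ->
  (forall eps : R, 0 < eps ->
     exists O : set 'cV[R]_n, [/\ open O, K `<=` O &
       forall F : set 'cV[R]_n, compact F -> K `<=` F -> F `<=` O ->
         (capacity p Q F <= capacity p Q K + eps%:E)%E]) /\
  (forall K_ : nat -> set 'cV[R]_n,
     (forall j, compact (K_ j)) -> (forall j, K_ j.+1 `<=` K_ j) ->
     (fun j => capacity p Q (K_ j)) @ \oo --> capacity p Q (\bigcap_j K_ j)).
Proof.
move=> n2 m1 p1 _ [_ _ _ Q0] _.
have nm0 : (0 < n * m)%N by rewrite muln_gt0 (ltnW n2).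
have p0 : 0 < p by rewrite (lt_le_trans _ p1).
split=> [eps eps0|K_ cK dK].
  have [U [oU KU HU]] := capacity_upper_semicontinuous p Q K eps nm0 p0 Q0 eps0.
  by exists U; split=> // F _ _; exact: HU.
(* A nonincreasing sequence of extended reals always converges to its infimum, so only the value of
   the limit is in question. *)
suff -> : capacity p Q (\bigcap_j K_ j) =
    ereal_inf (range (fun j => capacity p Q (K_ j))).
  apply: ereal_nonincreasing_cvgn; apply/nonincreasing_seqP => j.
  exact/le_capacity/dK.
apply/eqP; rewrite eq_le; apply/andP; split.
  by apply: le_ereal_inf_tmp => _ [j _ <-]; apply: le_capacity => x /(_ j I).
apply/lee_addgt0Pr => eps eps0.
have [U [oU KU HU]] := capacity_upper_semicontinuous p Q (\bigcap_j K_ j)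
  eps nm0 p0 Q0 eps0.
have [j KjU] := nested_compact_sub_open _ K_ U (@norm_hausdorff _ _) cK dK oU KU.
by apply: le_trans (HU _ KjU); apply: ereal_inf_lbound; exists j.
Qed.
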